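(* Let $G$ be an $r$-regular graph having a $p$-partition. Assume that $G$ is $H'$-distance magic for an Abelian group $H'$. Let $\Gamma$ be a finite Abelian group which contains a subgroup $H \le \Gamma$ such that $H' \cong H$. Let $t=|\Gamma|/|H|$ denote the index of $H$ in $\Gamma$. Assume that either $p$ is even or $t$ is odd. Then $tG$ has a $\Gamma$-distance magic labeling.
   Context: All graphs are finite and simple and all groups are finite Abelian groups written additively. For a graph $G=(V,E)$, $N(x)$ denotes the set of neighbors of a vertex $x$. $G$ is $r$-regular if $|N(x)|=r$ for all $x\in V$. For an Abelian group $\Gamma$ of order $|V|$, a $\Gamma$-distance magic labeling of $G$ is a bijection $\ell: V\to\Gamma$ for which there is $\mu\in\Gamma$ (the magic constant) such that the weight $w(x)=\sum_{y\in N(x)}\ell(y)$ equals $\mu$ for every $x\in V$. $G$ is $\Gamma$-distance magic if such a labeling exists (in particular $|\Gamma|=|V|$). For a positive integer $t$, $tG$ denotes the disjoint union of $t$ copies of $G$. For an integer $p\ge 2$, a $p$-partition of $G$ is a partition $V=V_1\cup\cdots\cup V_p$ into pairwise disjoint non-empty sets such that $|N(x)\cap V_1|=|N(x)\cap V_2|=\cdots=|N(x)\cap V_p|$ for every $x\in V$. *)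

(* Defs.v *)
From HB Require Import structures.
From mathcomp Require Import all_boot all_algebra all_fingroup.

Set Implicit Arguments.
Unset Strict Implicit.
Unset Printing Implicit Defensive.

Import GRing.Theory.
Local Open Scope ring_scope.

Record sgraph := SGraph {
  vertex :> finType;
  adj : rel vertex;
  adj_sym : symmetric adj;
  adj_irrefl : irreflexive adj
}.

Definition neigh (G : sgraph) (x : G) : {set G} := [set y | adj x y].

Definition regular (r : nat) (G : sgraph) : Prop :=
  forall x : G, #|neigh x| = r.

Section Copies.
Variables (t : nat) (G : sgraph).

Definition copies_adj : rel ('I_t * G) :=
  fun u v => (u.1 == v.1) && adj u.2 v.2.

Lemma copies_adj_sym : symmetric copies_adj.
Proof. by move=> u v; rewrite /copies_adj eq_sym adj_sym. Qed.

Lemma copies_adj_irrefl : irreflexive copies_adj.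
Proof. by move=> u; rewrite /copies_adj adj_irrefl andbF. Qed.

Definition copies : sgraph := SGraph copies_adj_sym copies_adj_irrefl.
End Copies.

(* The parts are an unindexed family: [partition] makes them non-empty and
   pairwise disjoint, hence distinct, so that there are p of them exactly when
   P has p elements. *)
Definition is_p_partition (p : nat) (G : sgraph) (P : {set {set G}}) : Prop :=
  [/\ (2 <= p)%N, #|P| = p, partition P [set: G] &
      forall (x : G) (A B : {set G}), A \in P -> B \in P ->
        #|neigh x :&: A| = #|neigh x :&: B|].

Definition has_p_partition (p : nat) (G : sgraph) : Prop :=
  exists P : {set {set G}}, is_p_partition p P.

Definition weight (G : sgraph) (Gamma : finZmodType) (l : G -> Gamma) (x : G) :
  Gamma := \sum_(y in neigh x) l y.

Definition distance_magic_labeling (G : sgraph) (Gamma : finZmodType)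
    (l : G -> Gamma) : Prop :=
  bijective l /\ exists mu : Gamma, forall x : G, weight l x = mu.

Definition distance_magic (Gamma : finZmodType) (G : sgraph) : Prop :=
  exists l : G -> Gamma, distance_magic_labeling l.

(* Main.v *)
Require Import Defs.
From mathcomp Require Import all_boot all_algebra all_fingroup cyclic zify.

(** Let [a] list one representative of each of the [t] cosets of [H], and let
    [m] be a magic labeling of [G] with values in [H].  Adding to [m x], in the
    [i]-th copy of a vertex [x] of the [j]-th part, the representative
    [a (s j i)], where every [s j] is a permutation of the [t] indices, yields
    a bijection onto [Gamma]: the coset of a label determines [s j i], hence
    the representative added, hence [m x], hence [x] and [j], hence [i].
    Each part contains the same number [k] of neighbours of [x], with
    [p * k = r], so the weight of [x] in copy [i] is the magic constant of [m]
    plus [k] times the sum of [a (s j i)] over [j < p].  What is needed is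
    therefore a transversal of [H] whose entries can be arranged in a [p]-row
    array, every row a permutation of the transversal, with constant column
    sums (a Kotzig array, when the entries are 0, ..., t-1).

    It is essential that all rows run through the same transversal: rows made
    of different representatives of the cosets could give equal labels to
    vertices of different parts.  So it is not enough to work in [Gamma / H],
    and the transversal itself has to be chosen well
    ([magic_transversal_exists]).  When [Gamma / H] is cyclic, the arithmetic
    progression [0, g, ..., (n-1)g] will do ([kotzig_progression]): two rows
    are balanced by reversal, three rows by an explicit array if [n] is odd,
    and these blocks are stacked to reach [p] rows.  In general, [H] is joined
    to [Gamma] by a chain of subgroups with cyclic successive quotients, and
    the sums of one term from each progression form the transversal, the arrays
    being combined coordinatewise ([kotzig_product]).  When [p] is odd, each
    quotient has odd order, since its order divides [t]. *)

Set Implicit Arguments.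
Unset Strict Implicit.
Unset Printing Implicit Defensive.

Import GRing.Theory.
Local Open Scope ring_scope.

(** * Arrays with constant column sums *)

(** Rows are indexed by all of [nat], of which only the first [p] matter: this
    spares dependent indices when arrays are stacked. *)
Definition kotzig (V : nmodType) (I : finType) (p : nat) (a : I -> V) : Prop :=
  exists (s : nat -> I -> I) (mu : V),
    (forall j, injective (s j)) /\ forall i, \sum_(j < p) a (s j i) = mu.

Lemma kotzig_stack (V : nmodType) (I : finType) (p q : nat) (a : I -> V) :
  kotzig p a -> kotzig q a -> kotzig (p + q) a.
Proof.
move=> [s [mu [s_inj s_sum]]] [s' [mu' [s'_inj s'_sum]]].
exists (fun j => if (j < p)%N then s j else s' (j - p)%N), (mu + mu').
split=> [j|i]; first by case: ifP.
rewrite big_split_ord /= -(s_sum i) -(s'_sum i); congr (_ + _).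
  by apply: eq_bigr => j _; rewrite ltn_ord.
by apply: eq_bigr => j _; rewrite ltnNge leq_addr addKn.
Qed.

Lemma kotzig_double (V : nmodType) (I : finType) (a : I -> V) (m : nat) :
  kotzig 2 a -> kotzig m.*2 a.
Proof.
move=> a2; elim: m => [|m IHm]; last exact: kotzig_stack a2 IHm.
by exists (fun _ => id), 0; split=> [j|i]; [exact: inj_id | rewrite big_ord0].
Qed.

Lemma kotzig_product (V : nmodType) (I J : finType) (p : nat)
    (a : I -> V) (b : J -> V) :
  kotzig p a -> kotzig p b -> kotzig p (fun ij : I * J => a ij.1 + b ij.2).
Proof.
move=> [s [mu [s_inj s_sum]]] [s' [mu' [s'_inj s'_sum]]].
exists (fun j u => (s j u.1, s' j u.2)), (mu + mu'); split=> [j|[i i']].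
  by move=> [x y] [x' y'] /= [/s_inj -> /s'_inj ->].
by rewrite big_split /= s_sum s'_sum.
Qed.

Lemma kotzig_reindex (V : nmodType) (I J : finType) (p : nat) (a : I -> V)
    (f : J -> I) :
  bijective f -> kotzig p a -> kotzig p (a \o f).
Proof.
move=> [g fK gK] [s [mu [s_inj s_sum]]].
exists (fun j => g \o s j \o f), mu; split=> [j|i].
  by move=> x y /= /(can_inj gK)/s_inj/(can_inj fK).
by rewrite -(s_sum (f i)); apply: eq_bigr => j _ /=; rewrite gK.
Qed.

Lemma kotzig2_progression (V : nmodType) (g : V) (n : nat) :
  kotzig 2 (fun i : 'I_n => g *+ i).
Proof.
exists (fun j => if j == 0%N then id else @rev_ord n), (g *+ n.-1).
split=> [j|i]; first by case: ifP => _; [exact: inj_id | exact: rev_ord_inj].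
rewrite !big_ord_recr big_ord0 /= add0r -mulrnDr; congr (_ *+ _).
by have := ltn_ord i; lia.
Qed.

(** For [n = 2m + 1], shifting the row [0, ..., 2m] cyclically by [m] and adding
    it to itself gives every value between [m] and [3m] exactly once, so the
    third row can complete each column to [3m]. *)
Lemma kotzig3_progression (V : nmodType) (g : V) (n : nat) :
  odd n -> kotzig 3 (fun i : 'I_n => g *+ i).
Proof.
move=> n_odd; have [m ->] : exists m, n = m.*2.+1.
  by exists n./2; rewrite -[LHS]odd_double_half n_odd.
pose row j (i : nat) : nat :=
  if j == 0%N then i
  else if j == 1%N then (if i <= m then i + m else i - m.+1)%N
  else (if i <= m then (m - i).*2 else (m.*2 - i).*2.+1)%N.
have row_lt j (i : 'I_m.*2.+1) : (row j i < m.*2.+1)%N.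
  by have := ltn_ord i; rewrite /row; do !case: ifP => ?; lia.
exists (fun j i => Ordinal (row_lt j i)), (g *+ (3 * m)); split=> [j|i].
  move=> x y [] row_eq; apply/val_inj; move: row_eq.
  have := ltn_ord x; have := ltn_ord y; rewrite /row /=.
  by do !case: ifP => ?; lia.
rewrite !big_ord_recr big_ord0 /= add0r -!mulrnDr; congr (_ *+ _).
by have := ltn_ord i; rewrite /row /=; case: ifP => ?; lia.
Qed.

Lemma kotzig_progression (V : nmodType) (g : V) (n p : nat) :
  (2 <= p)%N -> ~~ odd p \/ odd n -> kotzig p (fun i : 'I_n => g *+ i).
Proof.
move=> p_ge2 p_even_or_n_odd; have g2 := kotzig2_progression g n.
have [p_odd|p_even] := boolP (odd p); last first.
  by rewrite -[p]even_halfK //; apply: kotzig_double.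
have n_odd : odd n by case: p_even_or_n_odd; first by rewrite p_odd.
have -> : p = (3 + (p - 3)./2.*2)%N by lia.
exact: kotzig_stack (kotzig3_progression g n_odd) (kotzig_double _ g2).
Qed.

(** * Transversals that can be arranged in such arrays *)

(** The induction climbs from [H] by adjoining one element [g] at a time: if
    [n] is the order of [g] modulo [H], then [0, g, ..., (n-1)g] is a
    transversal of [H] in [<H, g>].  Injectivity modulo [H] together with the
    right number of indices makes [a] a transversal. *)
Lemma magic_transversal_exists (Gamma : finZmodType) (H : {group Gamma})
    (p : nat) :
  (2 <= p)%N -> ~~ odd p \/ odd #|[set: Gamma] : H|%g ->
  exists (I : finType) (a : I -> Gamma),
    [/\ #|I| = #|[set: Gamma] : H|%g,
        forall i j, a i - a j \in H -> i = j & kotzig p a].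
Proof.
move=> p_ge2.
have [d] := ubnP #|[set: Gamma] : H|%g; elim: d H => // d IHd H lt_d par.
have [HT|] := boolP ([set: Gamma] \subset H).
  exists unit, (fun=> 0); split=> [||].
  - by have := indexg_eq1 [set: Gamma] H; rewrite HT card_unit => /eqP.
  - by case; case.
  - exists (fun _ => id), 0.
    by split=> [j|i]; [exact: inj_id | rewrite big1].
case/subsetPn => g _ gNH.
have nHA (A : {set Gamma}) : (A \subset 'N(H))%g.
  apply: subset_trans (subsetT A) _.
  exact: sub_abelian_norm (FinRing.zmod_abelian _) (subsetT H).
pose K := (H <*> <[g]>)%G.
have sHK : H \subset K by apply: joing_subl.
have gK : g \in K by rewrite (subsetP (joing_subr _ _)) // cycle_id.
pose n := #[coset H g]%g.
have gN : (g \in 'N(H))%g by rewrite (subsetP (nHA setT)).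
have nE : n = #|K : H|%g.
  by rewrite -card_quotient ?nHA // quotientYidl ?nHA // quotient_cycle.
have TE : #|[set: Gamma] : H|%g = (#|[set: Gamma] : K|%g * n)%N.
  by rewrite nE (Lagrange_index (subsetT K) sHK).
have n_gt1 : (1 < n)%N.
  rewrite nE indexg_gt1; apply: contra gNH => sKH; exact: (subsetP sKH).
have [||I [a [cardI a_inj a_kotzig]]] := IHd K.
- apply: leq_trans (_ : #|[set: Gamma] : K|%g < #|[set: Gamma] : H|%g)%N _ => //.
  by rewrite TE ltn_Pmulr.
- by case: par => [|]; [left | rewrite TE oddM => /andP[]; right].
exists (I * 'I_n)%type, (fun u : I * 'I_n => a u.1 + g *+ u.2); split.
- by rewrite card_prod card_ord cardI TE.
- move=> [i k] [j l] /=; rewrite opprD addrACA => inH.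
  have ij : i = j.
    apply: a_inj; have /= := subsetP sHK _ inH.
    rewrite -FinRing.zmodMgE groupMr // -FinRing.zmodXgE -FinRing.zmodVgE.
    by rewrite groupM ?groupV -?FinRing.zmodXgE ?groupX.
  move: inH; rewrite ij subrr add0r => inH; congr (_, _).
  have : (coset H g ^+ k = coset H g ^+ l)%g.
    rewrite -!morphX //; apply/rcoset_kercosetP; rewrite ?groupX //.
    by rewrite mem_rcoset FinRing.zmodMgE FinRing.zmodVgE !FinRing.zmodXgE.
  by move/eqP; rewrite eq_expg_mod_order !modn_small // => /eqP/val_inj.
- apply: (kotzig_product (b := fun k : 'I_n => g *+ k)) => //.
  apply: kotzig_progression => //.
  by case: par => [|]; [left | rewrite TE oddM => /andP[_]; right].
Qed.

(** * The labeling of the copies *)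

Lemma sum_by_parts (V : nmodType) (T : finType) (P : {set {set T}})
    (N : {set T}) (F : {set T} -> V) :
  partition P [set: T] ->
  \sum_(y in N) F (pblock P y) = \sum_(A in P) F A *+ #|N :&: A|.
Proof.
move=> partP; have /and3P[/eqP coverP trivP _] := partP.
rewrite (partition_big (pblock P) (mem P)) /=; last first.
  by move=> y _; rewrite pblock_mem ?coverP.
apply: eq_bigr => A AP; rewrite -sumr_const.
apply: eq_big => [y|y /andP[_ /eqP ->] //]; rewrite inE; congr (_ && _).
apply/eqP/idP => [<-|]; last exact: def_pblock.
by rewrite mem_pblock coverP.
Qed.

Lemma sum_index_enum (V : nmodType) (T : finType) (P : {set T})
    (b : nat -> V) :
  \sum_(A in P) b (index A (enum P)) = \sum_(j < #|P|) b j.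
Proof.
rewrite big_enum_val; apply: eq_bigr => j _; congr b.
by rewrite index_uniq ?enum_uniq // -cardE.
Qed.

(* In the group notations below, a finZmodType is seen as a finGroupType for its
   addition. *)
Theorem theorem26 (G : sgraph) (r p : nat) (H' Gamma : finZmodType)
    (H : {group Gamma}) (t : nat) :
  regular r G ->
  has_p_partition p G ->
  distance_magic H' G ->
  ([set: H'] \isog H)%g ->
  t = #|[set: Gamma] : H|%g ->
  ~~ odd p \/ odd t ->
  distance_magic Gamma (copies t G).
Proof.
move=> G_reg [P [p_ge2 cardP partP balP]] [m [m_bij [c m_c]]].
case/isogP=> f f_inj fT tE par.
rewrite tE in par; have [I [a0 [cardI a0_inj]]] := magic_transversal_exists p_ge2 par.
rewrite -tE in cardI.
have e_bij : bijective (fun i : 'I_t => enum_val (cast_ord (esym cardI) i)).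
  apply: inj_card_bij; last by rewrite card_ord cardI.
  by move=> i j /enum_val_inj/cast_ord_inj.
move/(kotzig_reindex e_bij); set a := a0 \o _.
have a_inj i j : a i - a j \in H -> i = j.
  by move/a0_inj/(bij_inj e_bij).
move=> [s [mu [s_inj s_sum]]].
pose part x := index (pblock P x) (enum P).
have fH x : f (m x) \in H by rewrite -fT mem_morphim ?inE.
exists (fun u : 'I_t * G => f (m u.2) + a (s (part u.2) u.1)); split.
  apply: inj_card_bij => [[i x] [j y] /= lab_eq|]; last first.
    have cardG : #|G| = #|H|.
      by rewrite -fT card_injm // cardsT; apply: bij_eq_card m_bij.
    rewrite card_prod card_ord cardG.
    by rewrite tE -cardsT -(Lagrange (subsetT H)) mulnC.
  (* The two representatives differ by an element of [H], hence coincide. *)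
  have same_rep : s (part x) i = s (part y) j.
    apply: a_inj; have -> : a (s (part x) i) - a (s (part y) j) = f (m y) - f (m x).
      by apply/eqP; rewrite subr_eq addrAC -lab_eq addrAC subrr add0r.
    by rewrite -FinRing.zmodVgE -FinRing.zmodMgE groupM ?groupV.
  have xy : x = y.
    apply: (bij_inj m_bij); apply: (injmP f_inj); rewrite ?inE //.
    by move: lab_eq; rewrite same_rep => /addIr.
  by move: same_rep; rewrite xy => /s_inj ->.
exists (f c + mu *+ (r %/ p)) => -[i x]; rewrite /weight.
have sum_neigh (F : 'I_t * G -> Gamma) :
    \sum_(y in neigh ((i, x) : copies t G)) F y = \sum_(y in neigh x) F (i, y).
  rewrite (reindex_onto (pair i) snd) => [|[j y]]; last first.
    by rewrite inE /= /copies_adj /= => /andP[/eqP <-].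
  by apply: eq_bigl => y; rewrite !inE /= /copies_adj /= !eqxx andbT.
rewrite sum_neigh big_split /=; congr (_ + _).
  rewrite -(m_c x) /weight.
  apply: esym; apply: (big_morph f) => [y z|]; last exact: morph1.
  by rewrite -[y + z]FinRing.zmodMgE morphM ?inE.
(* The [p] equal counts add up to the degree [r], so none depends on [x]. *)
have k_eq A : A \in P -> #|neigh x :&: A| = (r %/ p)%N.
  move=> AP; have <- : (p * #|neigh x :&: A| = r)%N.
    rewrite -(G_reg x) -[RHS]sum1_card (sum_by_parts _ (fun=> 1%N) partP).
    under eq_bigr => B BP do rewrite (balP x B A BP AP).
    by rewrite sumr_const -mulrnA natn cardP mulnC.
  by rewrite mulKn // ltnW.
rewrite (sum_by_parts _ (fun A => a (s (index A (enum P)) i)) partP).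
under eq_bigr => A AP do rewrite (k_eq A AP).
rewrite sumrMnl; congr (_ *+ _).
by rewrite (sum_index_enum _ (fun j => a (s j i))) cardP s_sum.
Qed.
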